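(* Let $n \in \{1,2\}$ and equip $\mathbb{Z}^n$ with the $d_1$ (Manhattan) metric. Then for each real $r \geq n$, the Rips complex $\mathrm{Rips}(\mathbb{Z}^n, r)$ is contractible.
   Context: The $d_1$ metric on $\mathbb{R}^n$ (restricted to $\mathbb{Z}^n$) is $d_1((a_1,\dots,a_n),(b_1,\dots,b_n)) = \sum_{i=1}^n |a_i-b_i|$. For a metric space $(X,d)$ and $r\ge 0$, the (closed) Rips complex $\mathrm{Rips}(X,r)$ is the abstract simplicial complex with vertex set $X$ in which a nonempty finite subset $\sigma\subseteq X$ is a simplex if and only if $\mathrm{Diam}(\sigma)=\max_{x,y\in\sigma} d(x,y)\le r$. Contractibility of an abstract simplicial complex means contractibility of its geometric realization. *)

(* Defs.v *)
From HB Require Import structures.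
From mathcomp Require Import all_boot all_order all_algebra finmap.
From mathcomp Require Import all_classical all_reals all_analysis.

Set Implicit Arguments.
Unset Strict Implicit.
Unset Printing Implicit Defensive.

Import Order.TTheory GRing.Theory Num.Theory.
Import numFieldNormedType.Exports.

Local Open Scope classical_set_scope.
Local Open Scope ring_scope.

(* The vertices of [K] are the [v] such that [simplex K [fset v]%fset]; they
   need not exhaust the ambient type [V]. *)
Record simplicial_complex (V : choiceType) := SimplicialComplex {
  simplex : set {fset V};
  simplex_neq0 : forall s, simplex s -> s != fset0;
  simplex_face : forall s t, simplex s -> (t `<=` s)%fset -> t != fset0 ->
    simplex t
}.

Section Realization.
Context (R : realType) (V : choiceType) (K : simplicial_complex V).

(* Points of the geometric realization, in barycentric coordinates. *)
Record realization := Realization {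
  bary :> {fsfun V -> R with 0};
  bary_supp : simplex K (finsupp bary);
  bary_ge0 : forall v, 0 <= bary v;
  bary_sum : \sum_(v <- finsupp bary) bary v = 1
}.

Definition closed_simplex (s : {fset V}) : set realization :=
  [set x | (finsupp x `<=` s)%fset].

Definition bary_on (s : {fset V}) (x : realization) :
  prod_topology (fun _ : s => R) := fun v => x (val v).

Arguments bary_on : clear implicits.

(* The weak (coherent) topology: [U] is open iff its trace on each closed
   simplex [s] is open for the Euclidean topology inherited from [R^s]. *)
Definition realization_open (U : set realization) : Prop :=
  forall s, simplex K s -> exists2 W : set (prod_topology (fun _ : s => R)),
    open W & closed_simplex s `&` U = closed_simplex s `&` bary_on s @^-1` W.

Lemma realization_openT : realization_open setT.
Proof. by move=> s Ks; exists setT; [exact: openT | rewrite preimage_setT]. Qed.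

Lemma realization_openI : setI_closed realization_open.
Proof.
move=> A B oA oB s Ks; have [WA ? eA] := oA s Ks; have [WB ? eB] := oB s Ks.
exists (WA `&` WB); first exact: openI.
by rewrite preimage_setI setIIr eA eB -setIIr.
Qed.

Lemma realization_open_bigU (I : Type) (f : I -> set realization) :
  (forall i, realization_open (f i)) -> realization_open (\bigcup_i f i).
Proof.
move=> of_ s Ks.
have /choice[W hW] : forall i, exists W : set (prod_topology (fun _ : s => R)),
    open W /\ closed_simplex s `&` f i = closed_simplex s `&` bary_on s @^-1` W.
  by move=> i; have [W ? ?] := of_ i s Ks; exists W.
exists (\bigcup_i W i); first by apply: bigcup_open => i _; exact: (hW i).1.
rewrite preimage_bigcup 2!setI_bigcupr.
by apply: eq_bigcupr => i _; exact: (hW i).2.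
Qed.

HB.instance Definition _ := gen_eqMixin realization.
HB.instance Definition _ := gen_choiceMixin realization.
HB.instance Definition _ := isOpenTopological.Build realization
  realization_openT realization_openI realization_open_bigU.

End Realization.

Section Homotopy.
Context (R : realType).

(* Only the values of [H] on [S * [0, 1]] matter. *)
Definition homotopic (S T : topologicalType) (f g : S -> T) : Prop :=
  exists H : S * R -> T,
    [/\ {within [set p | 0 <= p.2 <= 1], continuous H},
        forall x, H (x, 0) = f x & forall x, H (x, 1) = g x].

Definition contractible_space (T : topologicalType) : Prop :=
  exists x0 : T, homotopic id (fun _ : T => x0).

Definition contractible (V : choiceType) (K : simplicial_complex V) : Prop :=
  contractible_space (realization R K).

End Homotopy.

Section Rips.
Context (R : realType) (X : metricType R).

(* [mdist] is nonnegative, so the default value [0] is harmless on nonempty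
   sets. *)
Definition diam (s : {fset X}) : R :=
  \big[Num.max/0]_(x <- s) \big[Num.max/0]_(y <- s) mdist x y.

Lemma diamP (s : {fset X}) (r : R) : 0 <= r ->
  diam s <= r <-> {in s &, forall x y, mdist x y <= r}.
Proof.
move=> r0; split=> [dr x y xs ys|h].
  apply: le_trans dr.
  apply: bigmax_sup_seq xs _ _ => //.
  exact: bigmax_sup_seq ys _ _.
by rewrite /diam !big_seq; apply: bigmax_le => // x xs;
  rewrite big_seq; apply: bigmax_le => // y ys; exact: h.
Qed.

Lemma diam_ge0 (s : {fset X}) : 0 <= diam s.
Proof. exact: bigmax_ge_id. Qed.

Variable r : R.

Definition Rips_simplex : set {fset X} :=
  [set s | s != fset0 /\ diam s <= r].

Lemma Rips_simplex_neq0 s : Rips_simplex s -> s != fset0.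
Proof. by case. Qed.

Lemma Rips_simplex_face s t : Rips_simplex s -> (t `<=` s)%fset ->
  t != fset0 -> Rips_simplex t.
Proof.
move=> [_ dsr] ts t0; split=> //; have r0 := le_trans (diam_ge0 s) dsr.
by apply/diamP => // x y xt yt; move/diamP: dsr; apply=> //;
  exact: (fsubsetP ts).
Qed.

Definition Rips : simplicial_complex X :=
  SimplicialComplex Rips_simplex_neq0 Rips_simplex_face.

Lemma Rips_vertex v : 0 <= r -> simplex Rips [fset v]%fset.
Proof.
move=> r0; split; first by apply/fset0Pn; exists v; rewrite inE.
by apply/diamP => // x y; rewrite !inE => /eqP-> /eqP->; rewrite mdistxx.
Qed.

End Rips.

Arguments Rips {R} X r.

Definition d1 (R : realType) (n : nat) (a b : 'rV[R]_n) : R :=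
  \sum_(i < n) `|a 0 i - b 0 i|.

(* The integer lattice, an alias carrying the metric [d1] rather than the
   sup-norm structure of row vectors. *)
Definition lattice (R : realType) (n : nat) : Type := 'rV[int]_n.

Section Lattice.
Context (R : realType) (n : nat).

Definition lattice_dist (a b : lattice R n) : R :=
  d1 (map_mx intr a) (map_mx intr b).

Lemma lattice_distxx a : lattice_dist a a = 0.
Proof. by rewrite /lattice_dist /d1 big1 // => i _; rewrite subrr normr0. Qed.

Lemma lattice_dist_eq0 a b : lattice_dist a b = 0 -> a = b.
Proof.
move=> /eqP; rewrite psumr_eq0 => [/allP h|i _]; last exact: normr_ge0.
apply/rowP => i; have /= := h i (mem_index_enum i).
by rewrite normr_eq0 subr_eq0 !mxE eqr_int => /eqP.
Qed.

Lemma lattice_dist_sym a b : lattice_dist a b = lattice_dist b a.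
Proof. by apply: eq_bigr => i _; rewrite distrC. Qed.

Lemma lattice_dist_triangle b a c :
  lattice_dist a c <= lattice_dist a b + lattice_dist b c.
Proof. by rewrite -big_split; apply: ler_sum => i _; exact: ler_distD. Qed.

HB.instance Definition _ := Choice.on (lattice R n).
HB.instance Definition _ := isMetric.Build R (lattice R n)
  lattice_distxx lattice_dist_eq0 lattice_dist_sym lattice_dist_triangle.

End Lattice.

(* Main.v *)
Require Import Defs.
From mathcomp Require Import all_boot all_order all_algebra finmap.
From mathcomp Require Import all_classical all_reals all_analysis.
From mathcomp Require Import zify lra.
Import Order.TTheory GRing.Theory Num.Theory.
Import numFieldNormedType.Exports.
Local Open Scope classical_set_scope.
Local Open Scope ring_scope.

(** Let [shrink v] move every nonzero coordinate of [v] one step towards [0].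
When [n <= 2], replacing [v] by [shrink v] brings it no further from any point
[u <> v] whose l1 norm is at most that of [v]; and [v] itself is within
distance [n <= r] of [shrink v] ([shrink_closer], [l1norm_sub_shrink]).  So in
the subcomplex spanned by the l1 ball of radius [k+1], every vertex of the
outer sphere is dominated by a vertex of the ball of radius [k], and the whole
sphere can be pushed inwards at once: the pushed simplex and the original one
span a common simplex.

Iterating gives maps [ball_retract k] of the lattice onto the ball of radius
[k].  Consecutive ones are contiguous, [ball_retract 0] is constant, and each
vertex is fixed by [ball_retract k] for all large [k].  A sequence with these
properties contracts every locally finite complex
([contractible_of_contiguous]): run the straight-line homotopies between
consecutive maps one after the other, the [k]-th one in the time interval
[[1/(k+2), 1/(k+1)]], and use the identity at time [0].  The motion of a vertex
is stationary near time [0], so it is continuous there too.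

Continuity into the weak topology is the remaining point.  Near a given point
of a locally finite complex all supports stay in one finite set of vertices,
the same then holds for their images, and as long as supports stay in a finite
set, convergence of barycentric coordinates implies weak convergence
([cvg_realization]). *)

(** * Barycentric coordinates and the weak topology *)

Section RealizationTopology.
Context {R : realType} {V : choiceType} {K : simplicial_complex V}.
Implicit Types (x y : realization R K) (s L : {fset V}).

Lemma realization_inj x y : (forall v, x v = y v) -> x = y.
Proof.
case: x y => [x Kx x0 x1] [y Ky y0 y1] /= xy.
have exy : x = y by exact/fsfunP.
by subst y; congr Realization; exact: Prop_irrelevance.
Qed.

Lemma bary_notin x s v : (finsupp x `<=` s)%fset -> v \notin s -> x v = 0.
Proof.
move=> xs vs; apply/eqP; rewrite -memNfinsupp.
by apply: contra vs; exact: (fsubsetP xs).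
Qed.

Lemma big_bary x s (F : V -> R) : (finsupp x `<=` s)%fset ->
  \sum_(u <- finsupp x) x u * F u = \sum_(u <- s) x u * F u.
Proof.
move=> xs; apply: big_fset_incl => // u _.
by rewrite memNfinsupp => /eqP ->; rewrite mul0r.
Qed.

(** The sum is taken over a finite set [L] that may differ from the simplex [s]:
it is convenient to bound the support of a candidate point in two ways, once by
a simplex and once by a set over which its coordinates are easily summed. *)
Lemma realization_exists s L (g : V -> R) : simplex K s ->
  (forall v, 0 <= g v) -> (forall v, v \notin s -> g v = 0) ->
  (forall v, v \notin L -> g v = 0) -> \sum_(v <- L) g v = 1 ->
  exists x, forall v, x v = g v.
Proof.
move=> Ks g0 gs gL g1.
pose b : {fsfun V -> R with 0} := [fsfun v in s => g v].
have bE v : b v = g v by rewrite fsfunE; case: ifPn => // /gs ->.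
have bs : (finsupp b `<=` s)%fset by exact: finsupp_sub.
have bL : (finsupp b `<=` L)%fset.
  apply/fsubsetP => v; rewrite mem_finsupp bE.
  by apply: contraNT => /gL ->.
have b1 : \sum_(v <- finsupp b) b v = 1.
  rewrite -g1 (big_fset_incl _ bL); last first.
    by move=> v _; rewrite memNfinsupp => /eqP.
  by apply: eq_bigr => v _; exact: bE.
have Kb : simplex K (finsupp b).
  apply: simplex_face Ks bs _; apply/negP => /eqP b0.
  by move/eqP: b1; rewrite b0 big_seq_fset0 eq_sym oner_eq0.
have b0 v : 0 <= b v by rewrite bE.
by exists (Realization Kb b0 b1).
Qed.

Lemma bary_continuous v : continuous (fun x => x v).
Proof.
apply/continuousP => A oA; rewrite /open /= => s Ks.
have [vs|vs] := boolP (v \in s).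
  exists (proj [` vs]%fset @^-1` A).
    by apply: open_comp => // z _; exact: proj_continuous.
  by [].
exists [set _ | A 0].
  have [A0|A0] := pselect (A 0).
    by rewrite (_ : [set _ | _] = setT); [exact: openT|apply/seteqP; split].
  by rewrite (_ : [set _ | _] = set0); [exact: open0|apply/seteqP; split].
by apply/seteqP; split=> x [xs /=]; rewrite (@bary_notin x s v xs vs).
Qed.

(** Only finitely many faces [s] lie in [L].  For each of them, the points of
the family with support exactly [s] are eventually in a given neighbourhood [U]
of [y]: if [y] lies in the closed simplex [s], this is how open sets are
defined; otherwise some coordinate of [y] outside [s] is positive, hence eventually
positive along the family, and no such points remain. *)
Lemma cvg_realization (T : Type) (F : set_system T) {FF : Filter F}
    (phi : T -> realization R K) y L :
  (\forall i \near F, (finsupp (phi i) `<=` L)%fset) ->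
  (forall v, phi i v @[i --> F] --> y v) -> phi @ F --> y.
Proof.
move=> phiL phiy A; rewrite nbhsE => -[U [oU Uy] UA].
suff : \forall i \near F, forall s : fpowerset L,
    finsupp (phi i) = val s -> U (phi i).
  apply: filterS2 phiL => i iL h; apply: UA.
  have iP : finsupp (phi i) \in fpowerset L by rewrite fpowersetE.
  exact: (h [` iP]%fset).
apply: filter_forall => -[s /= _].
have [Ks|Ks] := pselect (simplex K s); last first.
  by apply: nearW => i si; case: Ks; rewrite -si; exact: bary_supp.
have [ys|] := boolP (finsupp y `<=` s)%fset.
  have [W oW UW] := oU s Ks.
  have Wy : W (bary_on (s:=s) y).
    have : (closed_simplex s `&` U) y by [].
    by rewrite UW => -[].
  have : \forall i \near F, W (bary_on (s:=s) (phi i)).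
    suff : bary_on (s:=s) (phi i) @[i --> F] --> bary_on (s:=s) y.
      by apply; exact: open_nbhs_nbhs.
    apply/cvg_sup => v; rewrite cvg_image; last first.
      by apply/seteqP; split=> // z _; exists (fun=> z).
    move=> B /phiy yB; exists (@^~ v @^-1` B); first exact: yB.
    by apply/seteqP; split=> [z [z' ? <-]|z Bz] //; exists (fun=> z).
  apply: filterS => i Wi si.
  have : (closed_simplex s `&` bary_on (s:=s) @^-1` W) (phi i).
    by split=> //; rewrite /closed_simplex /= si.
  by rewrite -UW => -[].
case/fsubsetPn => v vy vs.
have yv : 0 < y v by rewrite lt_neqAle bary_ge0 eq_sym -mem_finsupp vy.
have : \forall i \near F, 0 < phi i v.
  by apply: (cvgr_gt (y v)) => //; exact: phiy.
apply: filterS => i iv si; move: iv.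
by rewrite (@bary_notin _ s) ?ltxx // si.
Qed.

End RealizationTopology.

(** * Concatenating infinitely many straight-line homotopies *)

Section Ramp.
Context {R : realType}.
Implicit Types (t : R) (k : nat).

(** For [k > 0] this rises linearly from [0] at time [1/(k+1)] to [1] at time
[1/k], and is constant elsewhere.  Distinct ramps rise in non-overlapping
intervals, and [ramp 0 = 0] makes the differences
[ramp k.+1 - ramp k] a partition of unity on positive times. *)
Definition ramp k t : R :=
  Num.min 1 (Num.max 0 (k%:R * (k.+1%:R * t - 1))).

Lemma ramp_continuous k : continuous (ramp k).
Proof.
apply: min_fun_continuous; first exact: cst_continuous.
apply: max_fun_continuous; first exact: cst_continuous.
move=> t; apply: cvgM; first exact: cvg_cst.
by apply: cvgB; [apply: cvgM; [exact: cvg_cst|exact: cvg_id]|exact: cvg_cst].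
Qed.

Lemma ramp_ge0 k t : 0 <= ramp k t.
Proof. by rewrite le_min ler01 le_max lexx. Qed.

Lemma ramp_le1 k t : ramp k t <= 1.
Proof. by rewrite ge_min lexx. Qed.

Lemma ramp0n t : ramp 0 t = 0.
Proof. by rewrite /ramp mul0r maxxx min_r. Qed.

Lemma ramp_at0 k : ramp k 0 = 0.
Proof. by rewrite /ramp mulr0 sub0r mulrN1 max_l ?min_r ?oppr_le0. Qed.

Lemma ramp_at1 k : ramp k.+1 1 = 1.
Proof.
rewrite /ramp mulr1 -(natrB _ (ltn0Sn k.+1)) subn1 /= -natrM max_r //.
by rewrite min_l // ler1n.
Qed.

Lemma ramp_saturated k t : 0 < ramp k t -> ramp k.+1 t = 1.
Proof.
rewrite lt_min ltr01 /= lt_max ltxx /= => kt.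
have k0 : 0 < k%:R :> R.
  rewrite lt_neqAle ler0n andbT.
  by apply: contraTneq kt => <-; rewrite mul0r ltxx.
move: kt; rewrite pmulr_rgt0 // subr_gt0 => kt.
apply/min_idPl; rewrite le_max; apply/orP; right.
rewrite -!natr1 in kt *; nra.
Qed.

Lemma ramp_leS k t : ramp k t <= ramp k.+1 t.
Proof.
have := ramp_ge0 k t; rewrite le_eqVlt => /predU1P[<-|/ramp_saturated ->].
  exact: ramp_ge0.
exact: ramp_le1.
Qed.

Lemma ramp_saturated_le j k t : (j < k)%N -> 0 < ramp j t -> ramp k t = 1.
Proof.
elim: k => // k IH; rewrite ltnS leq_eqVlt => /predU1P[->|jk] j0.
  exact: ramp_saturated.
by apply: ramp_saturated; rewrite IH.
Qed.

(** At any time at most one ramp, of index [k.+1], is strictly between [0] and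
[1].  The bound [m] absorbs the times [t <= 0], at which all ramps vanish and
[k] can be taken as large as desired. *)
Lemma ramp_cutoff m t : exists k, (forall j, (j <= k)%N -> ramp j t = 0) /\
  ((m <= k)%N \/ forall j, (k.+1 < j)%N -> ramp j t = 1).
Proof.
have eq0 j : ~~ (0 < ramp j t) -> ramp j t = 0.
  by rewrite lt_neqAle ramp_ge0 andbT negbK => /eqP <-.
have [[k kt]|none] := pselect (exists k, 0 < ramp k t); last first.
  exists m; split=> [j _|]; last by left.
  by apply: eq0; apply/negP => jt; apply: none; exists j.
case: (ex_minnP (ex_intro (fun k => 0 < ramp k t) k kt)).
move=> {k kt} -[|k] kt kmin.
  by rewrite ramp0n ltxx in kt.
exists k; split=> [j jk|]; last by right=> j kj; exact: ramp_saturated_le kt.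
by apply: eq0; apply/negP => /kmin; rewrite ltnNge jk.
Qed.

End Ramp.

Section Track.
Context {R : realType} {V : choiceType} (f : nat -> V -> V) (N : V -> nat).
Hypothesis fN : forall u k, (N u <= k)%N -> f k u = u.

(** The [v]-coordinate at time [t] of the vertex [u], which travels backwards
along the sequence [f], from [u = f (N u) u] at time [0] to [f 0 u] at time
[1]. *)
Definition track (u : V) (t : R) (v : V) : R :=
  \sum_(k < N u) (ramp k.+1 t - ramp k t) * (f k u == v)%:R
    + (1 - ramp (N u) t) * (u == v)%:R.

Definition trace (u : V) : {fset V} :=
  [fset f (val k) u | k in 'I_(N u).+1]%fset.

Lemma mem_trace k u : (k <= N u)%N -> f k u \in trace u.
Proof. by move=> kN; apply/imfsetP; exists (Ordinal (kN : k < (N u).+1)%N). Qed.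

Lemma track_continuous u v : continuous (fun t => track u t v).
Proof.
move=> t; apply: cvgD.
  apply: cvg_big => [|k _]; first exact: add_continuous.
  apply: cvgM; last exact: cvg_cst.
  by apply: cvgB; exact: ramp_continuous.
apply: cvgM; last exact: cvg_cst.
by apply: cvgB; [exact: cvg_cst|exact: ramp_continuous].
Qed.

Lemma track_ge0 u t v : 0 <= track u t v.
Proof.
rewrite addr_ge0 ?sumr_ge0 ?mulr_ge0 ?subr_ge0 ?ramp_le1 // => k _.
by rewrite mulr_ge0 // subr_ge0 ramp_leS.
Qed.

Lemma track_at0 u v : track u 0 v = (u == v)%:R.
Proof.
rewrite /track big1 => [|k _]; last by rewrite !ramp_at0 subrr mul0r.
by rewrite ramp_at0 subr0 mul1r add0r.
Qed.

Lemma track_at1 u v : track u 1 v = (f 0 u == v)%:R.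
Proof.
rewrite /track; case E: (N u) => [|n].
  by rewrite big_ord0 ramp0n subr0 mul1r add0r fN ?E.
rewrite big_ord_recl big1 => [|k _]; last by rewrite !ramp_at1 subrr mul0r.
by rewrite !ramp_at1 ramp0n subrr mul0r !addr0 subr0 mul1r.
Qed.

Lemma sum_track (u : V) (t : R) (L : {fset V}) : (trace u `<=` L)%fset ->
  \sum_(v <- L) track u t v = 1.
Proof.
move=> uL; have delta w : w \in L -> \sum_(v <- L) (w == v)%:R = 1 :> R.
  move=> wL; rewrite (big_fsetD1 w) //= eqxx big_seq big1 ?addr0 // => v.
  by rewrite !inE eq_sym => /andP[/negPf ->].
rewrite big_split exchange_big /= -mulr_sumr delta; last first.
  by rewrite -(fN u _ (leqnn (N u))) (fsubsetP uL) // mem_trace.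
under eq_bigr => k _.
  rewrite -mulr_sumr delta; last by rewrite (fsubsetP uL) // mem_trace // ltnW.
  rewrite mulr1; over.
rewrite -(big_mkord xpredT (fun k => ramp k.+1 t - ramp k t)) telescope_sumr //.
by rewrite ramp0n subr0 mulr1 addrC subrK.
Qed.

Lemma track_notin_trace u t v : v \notin trace u -> track u t v = 0.
Proof.
move=> vu; have fv k : (k <= N u)%N -> (f k u == v) = false.
  by move=> kN; apply: contraNF vu => /eqP <-; exact: mem_trace.
rewrite /track big1 => [|k _]; last by rewrite fv ?mulr0 // ltnW.
by rewrite -{2}(fN u _ (leqnn (N u))) fv ?mulr0 ?addr0.
Qed.

(** The index [k] is the same for all vertices [u]: this keeps the simultaneous
motion of the vertices of a simplex inside one simplex. *)
Lemma track_local m t : exists k, forall u v, (N u <= m)%N ->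
  v != f k u -> v != f k.+1 u -> track u t v = 0.
Proof.
have [k [k0 k1]] := ramp_cutoff m t; exists k => u v um vk vk1.
(* Either [f k.+1] already fixes [u], or the ramp of index [N u] is saturated
   and the resting term of [track] vanishes. *)
have Nu : (N u <= k.+1)%N \/ ramp (N u) t = 1.
  case: k1 => [mk|k1]; first by left; exact: leq_trans (leqW mk).
  by case: (leqP (N u) k.+1) => [|/k1]; [left|right].
rewrite /track big1 => [|[j /= jN] _].
  rewrite add0r; case: Nu => [/fN kN|->]; last by rewrite subrr mul0r.
  by rewrite -{2}kN eq_sym (negPf vk1) mulr0.
have [->|jk] := eqVneq j k; first by rewrite eq_sym (negPf vk) mulr0.
have [->|jk1] := eqVneq j k.+1; first by rewrite eq_sym (negPf vk1) mulr0.
have [jk'|kj] := leqP j.+1 k; first by rewrite !k0 ?subrr ?mul0r // ltnW.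
case: k1 => [mk|k1].
  have : (j < m)%N by exact: leq_trans um.
  lia.
by rewrite !k1 ?subrr ?mul0r //; lia.
Qed.

End Track.

(** * Contiguous sequences contract locally finite complexes *)

(** The homotopy is the affine extension of [track] to each simplex.  At a given
time it maps each simplex into the simplex spanned by two consecutive images,
thanks to [track_local] and contiguity. *)
Lemma contractible_of_contiguous (R : realType) (V : choiceType)
    (K : simplicial_complex V) (f : nat -> V -> V) (v0 : V) :
  simplex K [fset v0]%fset ->
  (forall u, f 0 u = v0) ->
  (forall u, exists N, forall k, (N <= k)%N -> f k u = u) ->
  (forall k s, simplex K s ->
     simplex K ([fset f k u | u in s] `|` [fset f k.+1 u | u in s])%fset) ->
  (forall v, exists L : {fset V},
     forall s, simplex K s -> v \in s -> (s `<=` L)%fset) ->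
  contractible R K.
Proof.
move=> Kv0 f0 /choice[N fN] Kf /choice[nb nbP].
pose tr t u v : R := track f N u t v.
pose traces (s : {fset V}) := (\bigcup_(u <- s) trace f N u)%fset.
have tracesP s u : u \in s -> (trace f N u `<=` traces s)%fset.
  by move=> us; exact: bigfcup_sup.
have H_exists (p : realization R K * R) : exists y : realization R K,
    forall v, y v = \sum_(u <- finsupp p.1) p.1 u * tr p.2 u v.
  case: p => x t /=; set s := finsupp x.
  have [k kP] := track_local f N fN (\max_(u <- s) N u) t.
  apply: (realization_exists _ (traces s) _ (Kf k s (bary_supp x))).
  - move=> v; rewrite sumr_ge0 // => u _.
    by rewrite mulr_ge0 ?bary_ge0 ?track_ge0.
  - move=> v; rewrite !inE negb_or => /andP[vk vk1].
    rewrite big_seq big1 // => u us; rewrite /tr kP ?mulr0 //.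
    + exact: leq_bigmax_seq.
    + by apply: contraNneq vk => ->; exact: in_imfset.
    + by apply: contraNneq vk1 => ->; exact: in_imfset.
  - move=> v vs; rewrite big_seq big1 // => u us.
    rewrite /tr track_notin_trace ?mulr0 //.
    by apply: contra vs; exact/fsubsetP/tracesP.
  - rewrite exchange_big /= -[RHS](bary_sum x) !big_seq; apply: eq_bigr => u us.
    by rewrite -mulr_sumr sum_track ?mulr1 ?tracesP.
have /choice[H HE] := H_exists.
have [c cE] : exists c : realization R K, forall v, c v = (v0 == v)%:R.
  apply: (realization_exists _ [fset v0]%fset _ Kv0) => [v|v|v|] //.
  - by rewrite inE eq_sym => /negPf ->.
  - by rewrite inE eq_sym => /negPf ->.
  - by rewrite big_seq_fset1 eqxx.
exists c, H; split=> [|x|x].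
- apply: continuous_subspaceT => -[x t].
  (* By local finiteness, the open star of a vertex [w] of the support of [x]
     is a neighbourhood of [x] with all supports in the finite set [nb w]. *)
  have [w wx] : exists w, w \in finsupp x.
    by apply/fset0Pn; exact: simplex_neq0 (bary_supp x).
  have xw : 0 < x w by rewrite lt_neqAle bary_ge0 eq_sym -mem_finsupp wx.
  have fst_cvg v : (p.1 : realization R K) v @[p --> (x, t)] --> x v.
    apply: (@cvg_comp _ _ _ fst (fun y : realization R K => y v) _ (nbhs x)).
      exact: cvg_fst.
    exact: bary_continuous.
  have near_nb : \forall p \near (x, t),
      (finsupp (p.1 : realization R K) `<=` nb w)%fset.
    have : \forall p \near (x, t), 0 < (p.1 : realization R K) w.
      exact: (cvgr_gt _ (fst_cvg w) _ xw).
    apply: filterS => p pw; apply: nbP; first exact: bary_supp.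
    by rewrite mem_finsupp gt_eqF.
  apply: (cvg_realization _ _ _ _ (traces (nb w))).
    apply: filterS near_nb => p pnb; apply/fsubsetP => v.
    rewrite mem_finsupp HE; apply: contraNT => vnb.
    rewrite big_seq big1 // => u /(fsubsetP pnb)/tracesP uw.
    rewrite /tr track_notin_trace ?mulr0 //.
    by apply: contra vnb; exact/fsubsetP.
  move=> v; rewrite HE /= (big_bary _ _ _ (nbhs_singleton near_nb)).
  have /near_eq_cvg : \forall p \near (x, t),
      \sum_(u <- nb w) (p.1 : realization R K) u * tr p.2 u v = H p v.
    by apply: filterS near_nb => p pnb; rewrite HE (big_bary _ _ _ pnb).
  move=> /cvg_trans; apply.
  apply: cvg_big => [|u _]; first exact: add_continuous.
  apply: cvgM; first exact: fst_cvg.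
  apply: (@cvg_comp _ _ _ snd (fun t' => track f N u t' v) _ (nbhs t)).
    exact: cvg_snd.
  exact: track_continuous.
- apply: realization_inj => v; rewrite HE /=.
  have [vx|vx] := boolP (v \in finsupp x).
    rewrite (big_fsetD1 v) //= /tr track_at0 eqxx mulr1.
    rewrite big_seq big1 ?addr0 // => u.
    by rewrite !inE track_at0 => /andP[/negPf -> _]; rewrite mulr0.
  move: (vx); rewrite memNfinsupp => /eqP ->; rewrite big_seq big1 // => u ux.
  rewrite /tr track_at0; case: eqP => [uv|]; last by rewrite mulr0.
  by rewrite -uv ux in vx.
- apply: realization_inj => v; rewrite HE cE /=.
  under eq_bigr do rewrite /tr (track_at1 f N fN) f0.
  by rewrite -mulr_suml bary_sum mul1r.
Qed.

(** * Shrinking l1 balls of the integer lattice *)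

Section LatticeRetraction.
Context {n : nat}.
Implicit Types u v w : 'rV[int]_n.

Definition l1norm v : nat := (\sum_i `|v 0%R i|)%N.

Definition shrink v : 'rV[int]_n := \row_i (v 0 i - sgz (v 0 i)).

Definition ball_step k v := if (l1norm v <= k)%N then v else shrink v.

(** Each application of [ball_step k] outside the ball of radius [k] lowers the
norm, so [l1norm v] iterations are enough to enter the ball. *)
Definition ball_retract k v := iter (l1norm v) (ball_step k) v.

Lemma l1norm_eq0 v : l1norm v = 0%N -> v = 0.
Proof.
move=> /eqP; rewrite sum_nat_eq0 => /forallP v0; apply/rowP => i.
by have := v0 i; rewrite absz_eq0 mxE => /eqP.
Qed.

Lemma l1norm_shrink v : (0 < l1norm v)%N -> (l1norm (shrink v) < l1norm v)%N.
Proof.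
rewrite !lt0n sum_nat_eq0 negb_forall => /existsP[i]; rewrite absz_eq0 => vi.
rewrite /l1norm (bigD1 i) //= [X in (_ < X)%N](bigD1 i) //= -addSn.
apply: leq_add; last by apply: leq_sum => j _; rewrite mxE; lia.
by rewrite mxE; lia.
Qed.

Lemma l1norm_sub_shrink v : (l1norm (v - shrink v) <= n)%N.
Proof.
apply: (@leq_trans (\sum_(i < n) 1)%N); last by rewrite sum1_card card_ord.
by apply: leq_sum => i _; rewrite !mxE subKr; lia.
Qed.

Lemma ball_step_fix k v : (l1norm v <= k)%N -> ball_step k v = v.
Proof. by rewrite /ball_step => ->. Qed.

Lemma l1norm_ball_step k v : (l1norm (ball_step k v) <= maxn k (l1norm v).-1)%N.
Proof.
rewrite /ball_step; case: (leqP (l1norm v) k) => vk.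
  by rewrite leq_max vk.
have := @l1norm_shrink v; lia.
Qed.

Lemma l1norm_iter_ball_step k m v : (l1norm v <= m + k)%N ->
  (l1norm (iter m (ball_step k) v) <= k)%N.
Proof.
elim: m v => // m IH v vm; rewrite iterSr; apply: IH.
have := l1norm_ball_step k v; lia.
Qed.

Lemma l1norm_ball_retract k v : (l1norm (ball_retract k v) <= k)%N.
Proof. by apply: l1norm_iter_ball_step; rewrite leq_addr. Qed.

Lemma ball_retract_fix k v : (l1norm v <= k)%N -> ball_retract k v = v.
Proof. by move=> vk; rewrite /ball_retract iter_fix ?ball_step_fix. Qed.

Lemma ball_retract_shrink k v : (k < l1norm v)%N ->
  ball_retract k v = ball_retract k (shrink v).
Proof.
move=> vk; have sv := @l1norm_shrink v.
rewrite /ball_retract -(@subnK (l1norm (shrink v)).+1 (l1norm v)); last by lia.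
rewrite addnS iterSr {2}/ball_step leqNgt vk /= iterD iter_fix //.
by rewrite ball_step_fix // l1norm_ball_retract.
Qed.

Lemma ball_retractS k v :
  ball_retract k v = ball_step k (ball_retract k.+1 v).
Proof.
have [m] := ubnP (l1norm v); elim: m v => // m IH v vm.
have sv := @l1norm_shrink v.
have [vk|vk] := leqP (l1norm v) k.+1.
  rewrite (ball_retract_fix _ _ vk) /ball_step; case: leqP => vk'.
    exact: ball_retract_fix.
  by rewrite ball_retract_shrink // ball_retract_fix //; lia.
rewrite ball_retract_shrink ?(ltnW vk) // (ball_retract_shrink k.+1) //.
by apply: IH; lia.
Qed.

Lemma ball_retract0 v : ball_retract 0 v = 0.
Proof. by apply: l1norm_eq0; apply/eqP; rewrite -leqn0 l1norm_ball_retract. Qed.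

End LatticeRetraction.

(** For one nonzero coordinate of [v], the step towards [0] increases the
distance to [u] by one if [u] is at least as far out in the direction of [v],
and otherwise decreases it by one.  If [u <> v] has norm at most that of [v],
then [u] cannot be at least as far out in all the nonzero coordinates of [v].
If there are at most two of these, an increase in one is therefore compensated
by a decrease in the other.  In higher dimension two increases could outweigh
a single decrease. *)
Lemma shrink_closer {n : nat} (n12 : n = 1%N \/ n = 2%N) (u v : 'rV[int]_n) :
  (l1norm u <= l1norm v)%N -> u <> v ->
  (l1norm (u - shrink v) <= l1norm (u - v))%N.
Proof.
have plane (a b x y : int) : (`|a| + `|b| <= `|x| + `|y|)%N ->
    ~ (a = x /\ b = y) ->
    (`|(a - (x - sgz x))%R| + `|(b - (y - sgz y))%R|
      <= `|(a - x)%R| + `|(b - y)%R|)%N by lia.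
move=> uv neq; case: n12 u v uv neq => -> u v; rewrite /l1norm.
  (* The line is the axis [y = 0] of the plane. *)
  rewrite !big_ord1 !mxE => uv neq.
  have := plane (u 0 0) 0 (v 0 0) 0; rewrite !addn0; apply=> // -[e _].
  by apply: neq; apply/rowP => i; rewrite ord1.
rewrite !big_ord_recl !big_ord0 !addn0 !mxE => uv neq.
apply: plane => // -[e0 e1]; apply: neq; apply/rowP => i.
by case: (unliftP ord0 i) => [j|] ->; rewrite ?ord1.
Qed.

(** * Contiguity in the Rips complex *)

Section LatticeRips.
Context {R : realType} {n : nat}.
Implicit Types u v : lattice R n.

Lemma mdist_l1norm u v : mdist u v = (l1norm (u - v : 'rV[int]_n))%:R :> R.
Proof.
rewrite /mdist /= /lattice_dist /d1 natr_sum; apply: eq_bigr => i _.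
by rewrite !mxE -intrB -intr_norm natr_absz.
Qed.

(** A box of integer radius [m >= r] around [v], as the image of a finite type,
contains the closed star of [v]. *)
Lemma Rips_lattice_locally_finite r v : exists L : {fset lattice R n},
  forall s, simplex (Rips (lattice R n) r) s -> v \in s -> (s `<=` L)%fset.
Proof.
pose m := Num.bound r.
pose box (A : 'rV['I_(m + m).+1]_n) : lattice R n :=
  \row_i ((v : 'rV[int]_n) 0 i + (A 0 i)%:Z - m%:Z).
exists [fset box A | A in 'rV['I_(m + m).+1]_n]%fset => s [_ sr] vs.
apply/fsubsetP => w ws; apply/imfsetP.
have r0 : 0 <= r by exact: le_trans (diam_ge0 s) sr.
have wr : mdist w v <= r by move/diamP: sr; exact.
have wm i : (`|((w : 'rV[int]_n) 0 i - (v : 'rV[int]_n) 0 i)%R| <= m)%N.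
  have : (l1norm (w - v : 'rV[int]_n) <= m)%N.
    rewrite -(ler_nat R) -mdist_l1norm (le_trans wr) // ltW //.
    exact: archi_boundP.
  by apply: leq_trans; rewrite /l1norm (bigD1 i) //= !mxE leq_addr.
exists (\row_i inord
    `|((w : 'rV[int]_n) 0 i - (v : 'rV[int]_n) 0 i + m%:Z)%R|%N).
  by [].
apply/rowP => i; rewrite !mxE; have := wm i => wmi.
by rewrite inordK; lia.
Qed.

Hypothesis n12 : n = 1%N \/ n = 2%N.
Variable r : R.
Hypothesis nr : n%:R <= r.

Lemma mdist_ball_step k u v : (l1norm u <= k.+1)%N -> (l1norm v <= k.+1)%N ->
  mdist u v <= r -> mdist u (ball_step k v : lattice R n) <= r.
Proof.
rewrite !mdist_l1norm /ball_step => uk vk.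
case: (leqP (l1norm v) k) => // kv uv.
(* The case [u = v] is where the bound [n <= r] enters. *)
have [->|/eqP neq] := eqVneq u v.
  by apply: le_trans nr; rewrite ler_nat l1norm_sub_shrink.
apply: le_trans uv; rewrite ler_nat (shrink_closer n12) //.
exact: leq_trans kv.
Qed.

(** Downward induction on [k], from the level at which [u] and [v] are both
fixed: one step of [mdist_ball_step] moves [v], and a second one, with the roles
exchanged, moves [u]. *)
Lemma mdist_ball_retract k u v : mdist u v <= r ->
  let g j w : lattice R n := ball_retract j w in
  mdist (g k u) (g k v) <= r /\ mdist (g k.+1 u) (g k v) <= r.
Proof.
move=> uv g.
have step j : mdist (g j.+1 u) (g j.+1 v) <= r ->
    mdist (g j u) (g j v) <= r /\ mdist (g j.+1 u) (g j v) <= r.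
  move=> juv; rewrite /g !(ball_retractS j).
  have juv' := mdist_ball_step j _ _ (l1norm_ball_retract _ _)
    (l1norm_ball_retract _ _) juv.
  split=> //; rewrite metric_sym; apply: mdist_ball_step.
  - by rewrite -ball_retractS ltnW // ltnS l1norm_ball_retract.
  - exact: l1norm_ball_retract.
  - by rewrite metric_sym.
apply: (step k); set d := maxn (l1norm u) (l1norm v).
have [m] := ubnP (d - k.+1)%N; elim: m k => // m IH k km.
have [dk|kd] := leqP d k.+1.
  rewrite /g !ball_retract_fix //; apply: leq_trans dk;
  by rewrite leq_max leqnn ?orbT.
by apply: (step _ _).1; apply: IH; lia.
Qed.

End LatticeRips.

Theorem theorem3p2 (R : realType) (n : nat) (hn : n = 1%N \/ n = 2%N)
  (r : R) (hr : n%:R <= r) : contractible R (Rips (lattice R n) r).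
Proof.
have r0 : 0 <= r by exact: le_trans hr.
apply: (@contractible_of_contiguous R (lattice R n) _ ball_retract 0).
- exact: Rips_vertex.
- exact: ball_retract0.
- by move=> u; exists (l1norm u) => k; exact: ball_retract_fix.
- move=> k s [s0 sr]; split.
    have /fset0Pn[u us] := s0; apply/fset0Pn; exists (ball_retract k u).
    by rewrite inE in_imfset.
  move/diamP: sr => /(_ r0) sr; apply/diamP => // x y.
  have close j u v us vs := mdist_ball_retract hn r hr j u v (sr u v us vs).
  rewrite !inE => /orP[]/imfsetP[u /= us ->] /orP[]/imfsetP[v /= vs ->].
  + exact: (close _ _ _ us vs).1.
  + by rewrite metric_sym; exact: (close _ _ _ vs us).2.
  + exact: (close _ _ _ us vs).2.
  + exact: (close _ _ _ us vs).1.
- exact: Rips_lattice_locally_finite.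
Qed.
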